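(* Let $\pi:E\to[n]$ be a surjection from a finite set $E$ with $|\pi^{-1}(i)|\ge2$ for every $i$. For every nonempty $\pi$-colored set $S$, the minimum support function of $\mathsf T_S-e_S$ restricts on the rays of $\Sigma_\pi$ to $$h(\mathsf T_S-e_S,e_R)=\mathrm f_S^\pi(e_R)-\sum_{s\in S}\ell_s(e_R)\qquad\text{for all nonempty }\pi\text{-colored }R.$$ Consequently, in the outward convention, the translated factor simplices and the translated truncations restrict to the nef basis $$\alpha_i\ (i\in[n]),\qquad \sum_{i\in I(S)}\alpha_i-[\mathrm f_S^\pi]\ \ (S\ \pi\text{-colored},\ |S|\ge2)$$ of the space of piecewise linear functions on $\Sigma_\pi$ modulo global linear functions. Moreover, if $\widehat{\mathsf T}_S=\operatorname{DTr}[\Delta(\mathbf E),\Delta(\overline{\mathbf E}(S))]$, then $$\left(h(\widehat{\mathsf T}_S,\cdot)-h(\Delta(\mathbf E),\cdot)\right)\big|_{\Sigma_\pi}=\mathrm f_S^\pi.$$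
   Context: Put $E_i=\pi^{-1}(i)$, $\mathbf E=(E_1,\dots,E_n)$, $e_T=\sum_{s\in T}e_s\in\mathbb R^E$ for $T\subseteq E$, and $\mathsf L(\mathbf E)=\operatorname{Span}\{e_{E_1},\dots,e_{E_n}\}$. A set $S\subseteq E$ is $\pi$-colored if $|S\cap E_i|\le1$ for every $i$. The $\pi$-colored fan $\Sigma_\pi$ in $\mathbb R^E/\mathsf L(\mathbf E)$ consists of the images of the cones $\operatorname{Cone}(e_{S_1},\dots,e_{S_k})$ for chains $S_1\subsetneq\dots\subsetneq S_k$ of nonempty $\pi$-colored sets. It is simplicial, so a piecewise linear function on $\Sigma_\pi$ (linear on each cone) is determined by arbitrary values on the ray generators $e_R$, $R$ nonempty $\pi$-colored. Global linear functions are restrictions of linear functionals on $\mathbb R^E/\mathsf L(\mathbf E)$; $[\cdot]$ denotes the class modulo these. Define piecewise linear functions by $\mathrm f_S^\pi(e_R)=1$ if $S\subseteq R$ and $0$ otherwise, and $\ell_s(e_R)=1$ if $s\in R$ and $0$ otherwise ($s\in E$). For $s,t\in E_i$ the difference $\ell_s-\ell_t$ is global linear; $\alpha_i$ denotes the common class of $\ell_s$, $s\in E_i$. Support functions are $h(\mathsf Q,u)=\min_{x\in\mathsf Q}u\cdot x$. The outward convention uses $h_{\max}(-\mathsf Q,u)=-h(\mathsf Q,u)$, where $h_{\max}(\mathsf Q,u)=\max_{x\in\mathsf Q}u\cdot x$. Thus the translated factor simplices contribute the classes of the restrictions of $h_{\max}(e_s-\Delta(E_i),\cdot)$ with $s\in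 E_i$ (equal to $\alpha_i$), and the translated truncations contribute the classes of the restrictions of $h_{\max}(e_S-\mathsf T_S,\cdot)$. A class is nef when, as here, it is represented by the restriction to $\Sigma_\pi$ of such an outward support function of a polytope $-\mathsf Q$ whose outer normal fan (equivalently the inner normal fan of $\mathsf Q$) coarsens the barycentric subdivision of the inner normal fan of $\Delta(\mathbf E)$. For a tuple $\mathbf T=(T_j)$ of disjoint nonempty subsets of $E$, $\Delta(\mathbf T)=\prod_j\operatorname{conv}\{e_s:s\in T_j\}\subset\mathbb R^E$ (zero in other coordinates). For $\mathbf A=(A_j)$ with $\emptyset\ne A_j\subseteq T_j$, not all equal, the deep truncation along the face $\Delta(\mathbf A)$ is $\operatorname{DTr}[\Delta(\mathbf T),\Delta(\mathbf A)]=\{x\in\Delta(\mathbf T) : \sum_j\sum_{s\in T_j\setminus A_j}x(s)\ge1\}$. For a nonempty $\pi$-colored $S$: $I(S)=\{i : S\cap E_i\ne\emptyset\}$, $\overline E_i(S)=E_i\setminus(S\cap E_i)$, $\mathbf E_S=(E_i)_{i\in I(S)}$, $\overline{\mathbf E}_S=(\overline E_i(S))_{i\in I(S)}$, $\overline{\mathbf E}(S)=(\overline E_1(S),\dots,\overline E_n(S))$, and $\mathsf T_S=\operatorname{DTr}[\Delta(\mathbf E_S),\Delta(\overline{\mathbf E}_S)]$. *)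

(* Defs.v *)
From HB Require Import structures.
From mathcomp Require Import all_boot all_order all_algebra.
From mathcomp Require Import generic_quotient ring_quotient.
From mathcomp Require Import boolp classical_sets functions reals.

Set Implicit Arguments.
Unset Strict Implicit.
Unset Printing Implicit Defensive.

Import Order.TTheory GRing.Theory Num.Theory.

Local Open Scope classical_set_scope.
Local Open Scope quotient_scope.
Local Open Scope ring_scope.

Section QuotientModule.
Variables (R : nzRingType) (V : lmodType R) (W : submodClosed V).

(* A submodule as a subgroup, which is what the library quotients by. *)
Definition submod_pred : {pred V} := W.
Fact submod_pred_zmod : zmod_closed submod_pred.
Proof. exact/GRing.submod_closedB/submodClosedP. Qed.
HB.instance Definition _ := GRing.isZmodClosed.Build V submod_pred submod_pred_zmod.

Definition quotmod : Type := Quotient.quot submod_pred.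
HB.instance Definition _ := GRing.Zmodule.on quotmod.

Definition cls (v : V) : quotmod := (\pi_(Quotient.quot submod_pred) v)%qT.

Lemma clsP (u v : V) : cls u = cls v <-> u - v \in W.
Proof.
rewrite -[u - v \in W]/(u - v \in submod_pred) Quotient.idealrBE.
by split=> /eqP.
Qed.

Definition qrepr (x : quotmod) : V := repr (x : Quotient.quot submod_pred).

Lemma qreprK : cancel qrepr cls. Proof. by move=> x; exact: reprK. Qed.

Lemma clsB : {morph cls : u v / u - v}.
Proof. by move=> u v; rewrite /cls raddfB. Qed.

Definition qscale (a : R) (x : quotmod) : quotmod := cls (a *: qrepr x).

Lemma qscale_cls a v : qscale a (cls v) = cls (a *: v).
Proof. by apply/clsP; rewrite -scalerBr rpredZ //; apply/clsP; rewrite qreprK. Qed.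

Lemma clsD : {morph cls : u v / u + v}.
Proof. by move=> u v; rewrite /cls raddfD. Qed.

Fact qscaleA a b x : qscale a (qscale b x) = qscale (a * b) x.
Proof. by rewrite -(qreprK x) !qscale_cls scalerA. Qed.
Fact qscale1 : left_id 1 qscale.
Proof. by move=> x; rewrite -(qreprK x) qscale_cls scale1r. Qed.
Fact qscaleDr : right_distributive qscale +%R.
Proof.
move=> a x y; rewrite -(qreprK x) -(qreprK y) -clsD !qscale_cls -clsD.
by rewrite scalerDr.
Qed.
Fact qscaleDl x : {morph qscale^~ x : a b / a + b}.
Proof. by move=> a b; rewrite -(qreprK x) !qscale_cls -clsD scalerDl. Qed.

HB.instance Definition _ :=
  GRing.Zmodule_isLmodule.Build R quotmod qscaleA qscale1 qscaleDr qscaleDl.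

Fact cls_scalable : scalable cls.
Proof. by move=> a v; rewrite -qscale_cls. Qed.
HB.instance Definition _ := GRing.isZmodMorphism.Build V quotmod cls clsB.
HB.instance Definition _ := GRing.isScalable.Build R V quotmod *:%R cls cls_scalable.
End QuotientModule.

Definition is_basis (R : nzRingType) (V : lmodType R) (I : finType)
    (b : I -> V) :=
  forall v, exists! c : {ffun I -> R}, v = \sum_i c i *: b i.

Section ConvexGeometry.
Variables (R : realType) (V : lmodType R).

Definition conv (s : seq V) : set V :=
  [set x | exists c : 'I_(size s) -> R,
    [/\ forall i, 0 <= c i, \sum_i c i = 1 & x = \sum_i c i *: s`_i]].

Definition polytope (Q : set V) := exists2 s : seq V, s != [::] & Q = conv s.

Definition cone (s : seq V) : set V :=
  [set x | exists2 c : 'I_(size s) -> R,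
    forall i, 0 <= c i & x = \sum_i c i *: s`_i].

Definition fan_support (F : set (set V)) : set V := \bigcup_(sigma in F) sigma.

Definition coarsens (F G : set (set V)) :=
  fan_support F = fan_support G /\
  forall tau, G tau -> exists2 sigma, F sigma & tau `<=` sigma.
End ConvexGeometry.

Section SupportFunctions.
Variables (R : realType) (E : finType).
Local Notation RE := {ffun E -> R^o}.

Definition dot (u x : RE) : R := \sum_s u s * x s.

(* For polytopes, which are compact, the infimum and the supremum are attained. *)
Definition hmin (Q : set RE) (u : RE) : R := inf [set dot u x | x in Q].
Definition hmax (Q : set RE) (u : RE) : R := sup [set dot u x | x in Q].

Definition face (Q : set RE) (w : RE) : set RE :=
  [set x | Q x /\ forall y, Q y -> dot w x <= dot w y].

Definition ind (T : {set E}) : RE := [ffun s => (s \in T)%:R].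

Definition simplex (T : {set E}) : set RE :=
  conv [seq ind [set s] | s <- enum T].

(* Tuples of subsets of E are indexed by a set J; in T and A only the
   components with index in J are used. *)
Variable I : finType.
Implicit Types (J : {set I}) (T A : I -> {set E}).

Definition prod_simplex J T : set RE :=
  [set x | exists2 y : I -> RE, forall j, j \in J -> simplex (T j) (y j)
                              & x = \sum_(j in J) y j].

Definition DTr J T A : set RE :=
  [set x | prod_simplex J T x /\
           1 <= \sum_(j in J) \sum_(s in T j :\: A j) x s].
End SupportFunctions.
Arguments ind R {E} T.
Arguments simplex R {E} T.
Arguments prod_simplex R {E I} J T.
Arguments DTr R {E I} J T A.

Section ColoredFan.
Variables (R : realType) (n : nat) (E : finType) (pi : E -> 'I_n).
Local Notation RE := {ffun E -> R^o}.

Definition block (i : 'I_n) : {set E} := [set s | pi s == i].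

Definition lineality : {vspace RE} :=
  <<[seq ind R (block i) | i <- enum 'I_n]>>%VS.

Definition NE : lmodType R := quotmod (pred_of_vspace lineality).
Definition proj (u : RE) : NE := cls (pred_of_vspace lineality) u.
Definition ray (T : {set E}) : NE := proj (ind R T).

Definition colored (S : {set E}) : bool := [forall i, #|S :&: block i| <= 1]%N.

Definition support_idx (S : {set E}) : {set 'I_n} :=
  [set i | S :&: block i != finset.set0].

Definition coblock (S : {set E}) (i : 'I_n) : {set E} :=
  block i :\: (S :&: block i).

Definition colored_fan : set (set NE) :=
  [set sigma | exists c : seq {set E},
    [/\ sorted (fun A B : {set E} => A \proper B) c,
        {in c, forall A, A != finset.set0 /\ colored A}
      & sigma = cone [seq ray A | A <- c]]].

(* A function on the support of the fan is represented by its extension by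
   zero to the whole space, so that it is determined by its restriction. *)
Definition is_pl (phi : NE -> R^o) : Prop :=
  (forall sigma, colored_fan sigma ->
     exists m : {linear NE -> R^o}, forall x, sigma x -> phi x = m x) /\
  (forall x, ~ fan_support colored_fan x -> phi x = 0).

Definition pl_pred : {pred NE -> R^o} := fun phi => `[< is_pl phi >].

Fact pl_submod : submod_closed pl_pred.
Proof.
split=> [|a f g /asboolP[lf zf] /asboolP[lg zg]]; apply/asboolP; split.
- by move=> sigma _; exists \0.
- by [].
- move=> sigma Fs; have [m mE] := lf _ Fs; have [p pE] := lg _ Fs.
  by exists ((a \*: m) \+ p) => x sx /=; rewrite /= -mE // -pE.
- by move=> x Fx; rewrite /GRing.add /= /GRing.scale /= zf // zg // scaler0 addr0.
Qed.
HB.instance Definition _ :=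
  GRing.isSubmodClosed.Build R (NE -> R^o) pl_pred pl_submod.

Record plfun := PLFun { plval :> NE -> R^o; plvalP : plval \in pl_pred }.
HB.instance Definition _ := [isSub for plval].
HB.instance Definition _ := [Choice of plfun by <:].
HB.instance Definition _ := [SubChoice_isSubLmodule of plfun by <:].

Definition global_linear : {pred plfun} := fun phi =>
  `[< exists m : {linear NE -> R^o},
        forall x, fan_support colored_fan x -> phi x = m x >].

Fact global_linear_submod : submod_closed global_linear.
Proof.
split=> [|a f g /asboolP[m mE] /asboolP[p pE]]; apply/asboolP.
- by exists \0.
- by exists ((a \*: m) \+ p) => x sx /=; rewrite /= -mE // -pE.
Qed.
HB.instance Definition _ :=
  GRing.isSubmodClosed.Build R plfun global_linear global_linear_submod.

Definition plclass : lmodType R := quotmod global_linear.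
Definition pl_cls (phi : plfun) : plclass := cls global_linear phi.

(* The fan is simplicial, so exactly one piecewise linear function takes the
   prescribed values on the rays; the default 0 is never used. *)
Definition pl_of_rays (v : {set E} -> R) : plfun :=
  xget 0 [set phi : plfun |
    forall T, T != finset.set0 -> colored T -> phi (ray T) = v T].

Definition fpi (S : {set E}) : plfun := pl_of_rays (fun T => (S \subset T)%:R).
Definition ell (s : E) : plfun := pl_of_rays (fun T => (s \in T)%:R).

(* When s and t lie in the same block, ell s - ell t is global linear, so the
   class is well defined as soon as the block is nonempty. *)
Definition alpha (i : 'I_n) : plclass :=
  xget 0 [set a | forall s, pi s = i -> pl_cls (ell s) = a].

(* The equality forces h to be invariant under the lineality space over the
   support of the fan, i.e. to descend to the quotient there. *)
Definition restricts_to (h : RE -> R) (phi : plfun) : Prop :=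
  forall u, fan_support colored_fan (proj u) -> h u = phi (proj u).

Definition represents (h : RE -> R) (a : plclass) : Prop :=
  exists2 phi, restricts_to h phi & pl_cls phi = a.

(* Every nonempty face of a polytope is the minimizing face of some w, so these
   are all the inner normal cones of Q. *)
Definition normal_cone (Q : set RE) (w : RE) : set NE :=
  [set proj u | u in [set u | face Q w `<=` face Q u]].

Definition normal_fan (Q : set RE) : set (set NE) := range (normal_cone Q).

(* Used for the normal fan of the product of the simplices on the blocks:
   this fan is simplicial, and its primitive ray generators are the images
   of the e_s. *)
Definition barycenter (sigma : set NE) : NE :=
  \sum_(s | ray [set s] \in sigma) ray [set s].

Definition barycentric (F : set (set NE)) : set (set NE) :=
  [set tau | exists c : seq (set NE),
    [/\ sorted (fun rho sigma => `[< rho `<` sigma >]) c,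
        {in c, forall sigma, F sigma /\ sigma <> [set 0]}
      & tau = cone [seq barycenter sigma | sigma <- c]]].

Definition Delta : set RE := prod_simplex R [set: 'I_n] block.

Definition nef (a : plclass) : Prop :=
  exists Q : set RE,
    [/\ polytope Q,
        coarsens (normal_fan Q) (barycentric (normal_fan Delta))
      & represents (hmax [set - x | x in Q]) a].

Definition trunc (S : {set E}) : set RE := DTr R (support_idx S) block (coblock S).
Definition full_trunc (S : {set E}) : set RE := DTr R [set: 'I_n] block (coblock S).

Definition nef_family
    (k : 'I_n + {S : {set E} | colored S && (1 < #|S|)%N}) : plclass :=
  match k with
  | inl i => alpha i
  | inr A => \sum_(i in support_idx (val A)) alpha i - pl_cls (fpi (val A))
  end.
End ColoredFan.
Arguments trunc R {n E} pi S.
Arguments full_trunc R {n E} pi S.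
Arguments Delta R {n E} pi.
Arguments nef_family R {n E} pi k.

(* Main.v *)
Require Import Defs.
From HB Require Import structures.
From mathcomp Require Import all_boot all_order all_algebra.
From mathcomp Require Import boolp classical_sets functions reals.

Set Implicit Arguments.
Unset Strict Implicit.
Unset Printing Implicit Defensive.

Import Order.TTheory GRing.Theory Num.Theory.

Local Open Scope classical_set_scope.
Local Open Scope ring_scope.

(** Write m_i(u) for the minimum of u over the block E_i. Subtracting m_i(u)
    from u on each block gives the reduction of u: a nonnegative vector with a
    zero in every block, which depends only on the class of u modulo the
    lineality space. For a nonempty S let g_S(u) be the minimum over S of the
    reduction of u.

    Everything rests on two formulas. First, for a point x of a product of
    simplices over a set J of blocks, u.x is the sum of the m_i(u), i in J,
    plus the pairing of x with the reduction of u. Hence the minimum over the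
    product is the sum of the m_i(u), and the minimum over its deep truncation
    along S, where x(S) >= 1, is that sum plus g_S(u); it is attained at a
    vertex that meets S ([DTr_is_minimum]). Second, let A_1, ..., A_k be a
    chain of sets none of which contains a block, and let u be a nonnegative
    combination of their indicators. Some s in S lies in exactly those A_j
    that contain S ([chain_witness]). With a block in the place of S this
    gives m_i(u) = 0, so u is its own reduction, and then g_S(u) is the sum of
    the coefficients of the A_j containing S. So g_S is piecewise linear on
    the colored fan and is f_S there, while ell_s is g_{s}, which gives all
    the stated support functions.

    For nefness, each class is represented, up to sign, by the minimum support
    function H of a polytope given by its vertices, and H is additive on the
    cone over every such chain. A minimizer of the sum of the indicators of the A_j then
    minimizes each of them, so the whole cone lies in one normal cone
    ([nef_conv]). It remains to know that every cone of the barycentric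
    subdivision is of this form ([barycentric_chain]) and that these cones
    cover the space ([barycentric_complete]): for a set A without a block, the
    image of the indicator of A is the barycenter of its normal cone, and a
    reduced vector is decomposed by peeling off its support.

    For the basis, Moebius inversion on the rays writes each piecewise linear
    function as a combination of the f_S ([pl_expansion]); this yields
    spanning, as the class of f_S is the sum of the alpha_i over I(S) minus
    the S-th member of the family, which vanishes for singletons. Conversely,
    a combination of the family that is globally linear is additive on the
    rays, which kills the coefficients of the f_S with |S| >= 2 by induction
    on |S|; summing over the rays of a block, whose total is zero, kills those
    of the alpha_i. *)

(** * Pairing and support functions *)

Section Dot.
Variables (R : realType) (E : finType).
Local Notation RE := {ffun E -> R^o}.
Implicit Types (u v x : RE) (Q : set RE) (m : R).

Fact dot_linear u : linear (dot u : RE -> R^o).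
Proof.
move=> a x y; rewrite /dot [RHS]/= /GRing.scale /= mulr_sumr -big_split /=.
by apply: eq_bigr => s _; rewrite !ffunE mulrDr mulrCA.
Qed.
HB.instance Definition _ u :=
  GRing.isLinear.Build R RE R^o *:%R (dot u : RE -> R^o) (dot_linear u).

Lemma dotC u x : dot u x = dot x u.
Proof. by rewrite /dot; apply: eq_bigr => s _; rewrite mulrC. Qed.

Lemma dot_ind u (A : {set E}) : dot u (ind R A) = \sum_(s in A) u s.
Proof.
rewrite /dot [RHS]big_mkcond /=; apply: eq_bigr => s _.
by rewrite ffunE; case: (s \in A); rewrite ?mulr1 ?mulr0.
Qed.

Lemma dot_ind1 u (s : E) : dot u (ind R [set s]%SET) = u s.
Proof. by rewrite dot_ind big_set1. Qed.

Lemma dotBr u x y : dot u (x - y) = dot u x - dot u y.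
Proof. exact: (linearB (dot u : RE -> R^o)). Qed.

Lemma dot_sumr (J : Type) (r : seq J) (P : pred J) (F : J -> RE) u :
  dot u (\sum_(j <- r | P j) F j) = \sum_(j <- r | P j) dot u (F j).
Proof. exact: (linear_sum (dot u : RE -> R^o)). Qed.

Lemma dot_combr (J : Type) (r : seq J) (a : J -> R) (F : J -> RE) u :
  dot u (\sum_(j <- r) a j *: F j) = \sum_(j <- r) a j * dot u (F j).
Proof.
rewrite dot_sumr; apply: eq_bigr => j _.
exact: (linearZ_LR (dot u : RE -> R^o)).
Qed.

Lemma dot_combl (J : Type) (r : seq J) (a : J -> R) (F : J -> RE) x :
  dot (\sum_(j <- r) a j *: F j) x = \sum_(j <- r) a j * dot (F j) x.
Proof. by rewrite dotC dot_combr; apply: eq_bigr => j _; rewrite dotC. Qed.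

(** The linear form given by u attains its minimum over Q, with value m. *)
Definition is_minimum Q u m :=
  (exists2 x, Q x & dot u x = m) /\ forall x, Q x -> m <= dot u x.

Lemma hmin_is_minimum Q u m : is_minimum Q u m -> hmin Q u = m.
Proof.
move=> [[x Qx xm] lb]; apply/eqP; rewrite eq_le; apply/andP; split.
- rewrite -xm; apply: ge_inf; last by exists x.
  by exists m => _ [y Qy <-]; exact: lb.
- by apply: lb_le_inf; [exists (dot u x), x | move=> _ [y Qy <-]; exact: lb].
Qed.

Lemma hmin_translate Q u v m :
  is_minimum Q u m -> hmin [set x - v | x in Q] u = m - dot u v.
Proof.
move=> [[x Qx xm] lb]; apply: hmin_is_minimum; split.
- by exists (x - v); [exists x | rewrite dotBr xm].
- by move=> _ [y Qy <-]; rewrite dotBr lerB // lb.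
Qed.

Lemma hmax_reflect Q u v m :
  is_minimum Q u m -> hmax [set v - x | x in Q] u = dot u v - m.
Proof.
move=> [[x Qx xm] lb]; apply/eqP; rewrite eq_le; apply/andP; split.
- apply: ge_sup; first by exists (dot u (v - x)), (v - x) => //; exists x.
  by move=> _ [_ [y Qy <-] <-]; rewrite dotBr lerB // lb.
- apply: ub_le_sup.
    by exists (dot u v - m) => _ [_ [y Qy <-] <-]; rewrite dotBr lerB // lb.
  by exists (v - x); [exists x | rewrite dotBr xm].
Qed.

Lemma hmax_opp Q u m : is_minimum Q u m -> hmax [set - x | x in Q] u = - m.
Proof.
move=> minQ; rewrite -[RHS]add0r -(raddf0 (dot u : {linear RE -> R^o})) /=.
rewrite -(hmax_reflect 0 minQ); congr (hmax _ u).
by apply/seteqP; split=> _ [x Qx <-]; exists x; rewrite ?sub0r.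
Qed.

Lemma mem_conv (V : lmodType R) (vs : seq V) (v : V) : v \in vs -> conv vs v.
Proof.
move=> vvs; have lt_v : (index v vs < size vs)%N by rewrite index_mem.
exists (fun i => (i == Ordinal lt_v)%:R); split=> [i | |].
- exact: ler0n.
- by rewrite (bigD1 (Ordinal lt_v)) //= eqxx big1 ?addr0 // => i /negPf->.
- rewrite (bigD1 (Ordinal lt_v)) //= eqxx scale1r nth_index // big1 ?addr0 //.
  by move=> i /negPf->; rewrite scale0r.
Qed.

Lemma conv_is_minimum (vs : seq RE) u m :
    (exists2 v, v \in vs & dot u v = m) -> {in vs, forall v, m <= dot u v} ->
  is_minimum (conv vs) u m.
Proof.
move=> [v vvs vm] lb; split; first by exists v => //; exact: mem_conv.
move=> _ [c [c0 c1 ->]]; rewrite dot_combr -[m]mul1r -c1 mulr_suml.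
by apply: ler_sum => i _; apply: ler_wpM2l => //; apply/lb/mem_nth.
Qed.

End Dot.
Arguments is_minimum {R E} Q u m.

(** * Minima over finite sets *)

Section MinOver.
Variables (R : realType) (E : finType).
Implicit Types (A : {set E}) (f : E -> R).

(** The minimum of f over A; the value 0 for empty A is never used. *)
Definition minover A f : R :=
  if [pick t in A] is Some t then f [arg min_(s < t in A) f s]%O else 0.

Lemma minover_ex A f :
  A != finset.set0 -> exists2 s, s \in A & f s = minover A f.
Proof.
move=> /set0Pn[t tA]; rewrite /minover.
case: pickP => [t' t'A|/(_ t)]; last by rewrite tA.
by case: arg_minP => // s sA _; exists s.
Qed.

Lemma minover_le A f s : s \in A -> minover A f <= f s.
Proof.
move=> sA; rewrite /minover; case: pickP => [t' t'A|/(_ s)]; last by rewrite sA.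
by case: arg_minP => // t tA; apply.
Qed.

Lemma minoverE A f s :
  s \in A -> {in A, forall t, f s <= f t} -> minover A f = f s.
Proof.
move=> sA lb; apply/eqP; rewrite eq_le minover_le //=.
have A0 : A != finset.set0 by apply/set0Pn; exists s.
by have [t tA <-] := minover_ex f A0; exact: lb.
Qed.
End MinOver.

(** * Reduced vectors and the minima over deep truncations *)

Section Reduction.
Variables (R : realType) (n : nat) (E : finType) (pi : E -> 'I_n).
Hypothesis pi_surj : forall i, exists s, pi s = i.
Local Notation RE := {ffun E -> R^o}.
Local Notation block := (block pi).
Implicit Types (u v x : RE) (S A : {set E}) (i j : 'I_n).

Lemma in_block i s : (s \in block i) = (pi s == i).
Proof. by rewrite inE. Qed.

Lemma block_neq0 i : block i != finset.set0.
Proof.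
by have [s ps] := pi_surj i; apply/set0Pn; exists s; rewrite in_block ps.
Qed.

Lemma mem_support_idx S s : s \in S -> pi s \in support_idx pi S.
Proof.
move=> sS; rewrite inE; apply/set0Pn; exists s.
by rewrite finset.in_setI sS in_block eqxx.
Qed.

Lemma sum_blocks (J : {set 'I_n}) (F : E -> R) :
  \sum_(i in J) \sum_(s in block i) F s = \sum_(s | pi s \in J) F s.
Proof.
rewrite (partition_big pi (mem J)) //=; apply: eq_bigr => i iJ.
apply: eq_bigl => s; rewrite in_block.
by case: eqP => [->|]; rewrite ?iJ // andbF.
Qed.

(** The minimum of u over the block of i. *)
Definition blockmin u i : R := minover (block i) u.

(** The representative of u modulo the lineality space that is nonnegative and
    vanishes somewhere on each block. *)
Definition reduce u : RE := [ffun s => u s - blockmin u (pi s)].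

(** The minimum over S of the reduction of u; on the colored fan this is the
    function that is 1 on the rays containing S and 0 on the others. *)
Definition redmin S u : R := minover S (reduce u).

Lemma blockminE u i s :
  s \in block i -> {in block i, forall t, u s <= u t} -> blockmin u i = u s.
Proof. exact: minoverE. Qed.

Lemma redminE S u s :
    s \in S -> {in S, forall t, reduce u s <= reduce u t} ->
  redmin S u = reduce u s.
Proof. exact: minoverE. Qed.

Lemma reduce_ge0 u s : 0 <= reduce u s.
Proof. by rewrite ffunE subr_ge0 minover_le // in_block. Qed.

Lemma reduce_vanishes u i : exists2 s, pi s = i & reduce u s = 0.
Proof.
have [s] := minover_ex u (block_neq0 i); rewrite in_block => /eqP ps us.
by exists s => //; rewrite ffunE us ps subrr.
Qed.

Lemma reduce_transversal u :
  exists t : 'I_n -> E, forall i, pi (t i) = i /\ reduce u (t i) = 0.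
Proof.
have [t pt ut] := fin_all_exists2 (reduce_vanishes u).
by exists t => i; split.
Qed.

Lemma reduce_id u :
  (forall s, 0 <= u s) -> (forall i, exists2 s, pi s = i & u s = 0) ->
  reduce u = u.
Proof.
move=> u0 uz; apply/ffunP => s; rewrite ffunE.
have [t pt ut] := uz (pi s).
by rewrite (@blockminE _ _ t) ?in_block ?pt ?ut ?subr0.
Qed.

Lemma blockmin_shift u v (c : 'I_n -> R) i :
  (forall s, u s - v s = c (pi s)) -> blockmin u i = blockmin v i + c i.
Proof.
move=> uv; have [s sB vs] := minover_ex v (block_neq0 i).
have uE t : u t = v t + c (pi t) by rewrite -uv addrC subrK.
have ps : pi s = i by apply/eqP; rewrite -in_block.
rewrite [LHS](minoverE sB) => [|t tB]; first by rewrite uE vs ps.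
have pt : pi t = i by apply/eqP; rewrite -in_block.
by rewrite !uE ps pt lerD2r vs minover_le.
Qed.

Lemma reduce_shift u v (c : 'I_n -> R) :
  (forall s, u s - v s = c (pi s)) -> reduce u = reduce v.
Proof.
move=> uv; apply/ffunP => s; rewrite !ffunE (blockmin_shift _ uv).
by rewrite -[u s](subrK (v s)) uv [c _ + _]addrC [blockmin v _ + _]addrC addrKA.
Qed.

Lemma redmin_shift S u v (c : 'I_n -> R) :
  (forall s, u s - v s = c (pi s)) -> redmin S u = redmin S v.
Proof. by move=> uv; rewrite /redmin (reduce_shift uv). Qed.

Lemma simplex_ge0 A x s : simplex R A x -> 0 <= x s.
Proof.
move=> [c [c0 _ ->]]; rewrite sum_ffunE sumr_ge0 // => i _.
rewrite !ffunE mulr_ge0 //.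
have /mapP[t _ ->] := mem_nth 0 (ltn_ord i).
by rewrite ffunE ler0n.
Qed.

Lemma simplex_off A x s : simplex R A x -> s \notin A -> x s = 0.
Proof.
move=> [c [_ _ ->]] sA; rewrite sum_ffunE big1 // => i _; rewrite !ffunE.
have /mapP[t] := mem_nth 0 (ltn_ord i).
rewrite mem_enum => tA ->; rewrite ffunE inE.
by case: eqP sA => [->|]; rewrite ?tA // scaler0.
Qed.

Lemma simplex_sum A x : simplex R A x -> \sum_(s in A) x s = 1.
Proof.
move=> [c [_ <- ->]]; rewrite -dot_ind dot_combl.
apply: eq_bigr => i _.
have /mapP[t] := mem_nth 0 (ltn_ord i).
by rewrite mem_enum => tA ->; rewrite dotC dot_ind1 ffunE tA mulr1.
Qed.

Lemma mem_simplex A s : s \in A -> simplex R A (ind R [set s]%SET).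
Proof. by move=> sA; apply/mem_conv/map_f; rewrite mem_enum. Qed.

Section ProdSimplex.
Variables (J : {set 'I_n}) (x : RE).
Hypothesis xJ : prod_simplex R J block x.

Lemma prod_simplex_block i :
  i \in J -> exists2 y, simplex R (block i) y & {in block i, x =1 y}.
Proof.
case: xJ => y Yy -> iJ; exists (y i); first exact: Yy.
move=> s; rewrite in_block sum_ffunE (bigD1 i) //= => /eqP ps.
rewrite big1 ?addr0 // => j /andP[jJ ji].
by rewrite (simplex_off (Yy j jJ)) // in_block ps eq_sym.
Qed.

Lemma prod_simplex_ge0 s : 0 <= x s.
Proof.
case: xJ => y Yy ->; rewrite sum_ffunE sumr_ge0 // => i iJ.
exact: simplex_ge0 (Yy i iJ).
Qed.

Lemma prod_simplex_sum i : i \in J -> \sum_(s in block i) x s = 1.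
Proof.
move=> /prod_simplex_block[y Yy xy]; rewrite (eq_bigr y) //.
exact: simplex_sum.
Qed.

Lemma prod_simplex_off s : pi s \notin J -> x s = 0.
Proof.
case: xJ => y Yy -> sJ; rewrite sum_ffunE big1 // => i iJ.
rewrite (simplex_off (Yy i iJ)) // in_block.
by apply: contraNneq sJ => ->.
Qed.

(** The key formula: the weights of x sum to 1 on each block of J. *)
Lemma dot_reduce u :
  dot u x = \sum_(i in J) blockmin u i + \sum_s reduce u s * x s.
Proof.
rewrite [\sum_s _](bigID [pred s | pi s \in J]) /=.
rewrite [X in _ + (_ + X)]big1 ?addr0.
  rewrite -sum_blocks -big_split /dot (bigID [pred s | pi s \in J]) /=.
  rewrite [X in _ + X]big1 ?addr0; last first.
    by move=> s /prod_simplex_off->; exact: mulr0.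
  rewrite -sum_blocks; apply: eq_bigr => i iJ.
  rewrite -[blockmin u i]mulr1 -(prod_simplex_sum iJ) mulr_sumr -big_split.
  apply: eq_bigr => s; rewrite in_block => /eqP ps /=.
  by rewrite ffunE ps -mulrDl addrC subrK.
by move=> s /prod_simplex_off->; exact: mulr0.
Qed.
End ProdSimplex.

(** The vertex of the product of the simplices on the blocks of J that picks the
    element t i in block i; it depends only on the values of t on J. *)
Definition vertex (J : {set 'I_n}) (t : 'I_n -> E) : RE :=
  \sum_(i in J) ind R [set t i]%SET.

Lemma dot_vertex (J : {set 'I_n}) (t : 'I_n -> E) u :
  dot u (vertex J t) = \sum_(i in J) u (t i).
Proof.
by rewrite dot_sumr; apply: eq_bigr => i _; rewrite dot_ind1.
Qed.

Lemma vertex_prod_simplex (J : {set 'I_n}) (t : 'I_n -> E) :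
  (forall i, pi (t i) = i) ->
  prod_simplex R J block (vertex J t).
Proof.
move=> pt; exists (fun i => ind R [set t i]%SET) => // i _.
by apply: mem_simplex; rewrite in_block pt.
Qed.

Lemma prod_simplex_is_minimum (J : {set 'I_n}) u :
  is_minimum (prod_simplex R J block) u (\sum_(i in J) blockmin u i).
Proof.
split=> [|x Qx]; last first.
  rewrite (dot_reduce Qx) lerDl sumr_ge0 // => s _.
  by rewrite mulr_ge0 ?reduce_ge0 ?(prod_simplex_ge0 Qx).
have [t ut] := reduce_transversal u.
exists (vertex J t).
  by apply: vertex_prod_simplex => i; case: (ut i).
rewrite dot_vertex; apply: eq_bigr => i _; have [pt] := ut i.
by rewrite ffunE pt => /eqP; rewrite subr_eq0 => /eqP.
Qed.

(** The vertex picks a minimizer of the reduction of u over S in one block and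
    zeros of the reduction in the others. *)
Lemma optimal_vertex S (J : {set 'I_n}) u :
    S != finset.set0 -> support_idx pi S \subset J ->
  exists t : 'I_n -> E, [/\ forall i, pi (t i) = i,
    exists2 i, i \in J & t i \in S
    & dot u (vertex J t) = \sum_(i in J) blockmin u i + redmin S u].
Proof.
move=> /(minover_ex (reduce u))[s sS us] SJ.
have sJ : pi s \in J := fintype.subsetP SJ _ (mem_support_idx sS).
have [t ut] := reduce_transversal u.
exists (fun i => if i == pi s then s else t i); split=> [i||].
- by case: eqP => [->|_] //; case: (ut i).
- by exists (pi s) => //; rewrite eqxx.
rewrite dot_vertex (bigD1 (pi s)) //= eqxx [in RHS](bigD1 (pi s)) //=.
rewrite [RHS]addrAC; congr (_ + _).
  by rewrite /redmin -us ffunE addrC subrK.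
apply: eq_bigr => i /andP[_ /negPf->]; have [pt] := ut i.
by rewrite ffunE pt => /eqP; rewrite subr_eq0 => /eqP.
Qed.

Lemma sum_coblock S (J : {set 'I_n}) x :
    support_idx pi S \subset J ->
  \sum_(i in J) \sum_(s in block i :\: coblock pi S i) x s = \sum_(s in S) x s.
Proof.
move=> SJ; rewrite [RHS](partition_big pi (mem J)) /= => [|s sS].
  apply: eq_bigr => i iJ; apply: eq_bigl => s.
  by rewrite !inE; case: (s \in S); case: (_ == _).
by rewrite (fintype.subsetP SJ) ?mem_support_idx.
Qed.

Lemma vertex_DTr S (J : {set 'I_n}) (t : 'I_n -> E) i :
    support_idx pi S \subset J -> (forall j, pi (t j) = j) ->
  i \in J -> t i \in S -> DTr R J block (coblock pi S) (vertex J t).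
Proof.
move=> SJ pt iJ tS; split; first exact: vertex_prod_simplex.
rewrite sum_coblock // -dot_ind dotC dot_vertex (bigD1 i) //= ffunE tS.
by rewrite lerDl sumr_ge0 // => j _; rewrite ffunE ler0n.
Qed.

Lemma DTr_is_minimum S (J : {set 'I_n}) u :
    S != finset.set0 -> support_idx pi S \subset J ->
  is_minimum (DTr R J block (coblock pi S)) u
    (\sum_(i in J) blockmin u i + redmin S u).
Proof.
move=> S0 SJ; split=> [|x [Qx]]; last first.
  rewrite sum_coblock // => x1; rewrite (dot_reduce Qx) lerD2l.
  (* As x(S) >= 1, the elements of S alone contribute at least redmin S u. *)
  have [s sS us] := minover_ex (reduce u) S0.
  have m0 : 0 <= redmin S u by rewrite /redmin -us reduce_ge0.
  rewrite -[redmin S u]mulr1; apply: le_trans (ler_wpM2l m0 x1) _.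
  rewrite mulr_sumr [leRHS](bigID (mem S)) /= -[leLHS]addr0.
  apply: lerD; [apply: ler_sum => r rS|apply: sumr_ge0 => r _].
    by rewrite ler_wpM2r ?(prod_simplex_ge0 Qx) // minover_le.
  by rewrite mulr_ge0 ?reduce_ge0 ?(prod_simplex_ge0 Qx).
have [t [pt [i iJ tS] ut]] := optimal_vertex u S0 SJ.
by exists (vertex J t) => //; exact: vertex_DTr iJ tS.
Qed.

End Reduction.

(** * Chains of sets and the quotient by the lineality space *)

Section Cones.
Variables (R : realType) (V : lmodType R) (T : Type) (f : T -> V) (x0 : T).

Lemma cone_mapP (c : seq T) x :
  cone [seq f A | A <- c] x <->
  exists2 a : nat -> R, forall k, 0 <= a k
                      & x = \sum_(k < size c) a k *: f (nth x0 c k).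
Proof.
split=> [[a a0 ->]|[a a0 ->]].
  exists (fun k => if insub k is Some i then a i else 0) => [k|].
    by case: insub.
  rewrite -(size_map f c); apply: eq_bigr => i _; rewrite insubT //= => lt_i.
  rewrite (nth_map x0); last by rewrite -(size_map f).
  by congr (a _ *: _); exact: val_inj.
exists (fun i => a i) => // ; rewrite -(size_map f c).
apply: eq_bigr => i _; rewrite (nth_map x0) //.
by rewrite -(size_map f).
Qed.
End Cones.

Section Chains.
Variables (R : realType) (n : nat) (E : finType) (pi : E -> 'I_n).
Hypothesis pi_surj : forall i, exists s, pi s = i.
Local Notation RE := {ffun E -> R^o}.
Local Notation block := (block pi).
Local Notation blockmin := (blockmin pi).
Local Notation reduce := (reduce pi).
Local Notation redmin := (redmin pi).
Implicit Types (u v x : RE) (S A : {set E}) (c : seq {set E}) (a : nat -> R).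

(** A contains no block, i.e. its indicator is already reduced. *)
Definition blockfree A := forall i, ~~ (block i \subset A).

(** Repetitions are allowed in a chain. *)
Definition is_chain c :=
  sorted (fun A B : {set E} => A \subset B) c /\ {in c, forall A, blockfree A}.

Lemma is_chain1 A : blockfree A -> is_chain [:: A].
Proof. by move=> bA; split=> // B; rewrite inE => /eqP->. Qed.

(** One element of S decides for all members of a chain whether they contain S:
    any element of S outside the largest member that does not contain S, if
    there is such a member. *)
Lemma chain_witness c S :
    sorted (fun A B : {set E} => A \subset B) c -> S != finset.set0 ->
  exists2 s, s \in S & {in c, forall A, (s \in A) = (S \subset A)}.
Proof.
move=> + S0; elim: c => [_|A c IH /= pAc].
  by have [s sS] := set0Pn _ S0; exists s.
have [s sS sc] := IH (path_sorted pAc).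
have AB : {in c, forall B : {set E}, A \subset B}.
  have tr : transitive (fun A B : {set E} => A \subset B).
    by move=> B C D; exact: fintype.subset_trans.
  by apply/allP; exact: order_path_min tr pAc.
have [SA|] := boolP (S \subset A).
  exists s => // B; rewrite inE => /orP[/eqP->|/sc//].
  by rewrite SA (fintype.subsetP SA).
move=> SnA.
have [/hasP[B Bc SnB]|/hasPn Sc] :=
  boolP (has (fun B : {set E} => ~~ (S \subset B)) c).
  exists s => // C; rewrite inE => /orP[/eqP->|/sc//].
  rewrite (negPf SnA); apply: contraNF SnB => sA.
  by rewrite -sc // (fintype.subsetP (AB B Bc)).
have /subsetPn[t tS tA] := SnA.
exists t => // C; rewrite inE => /orP[/eqP->|Cc].
  by rewrite (negPf SnA) (negPf tA).
have := Sc C Cc; rewrite negbK => SC.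
by rewrite SC (fintype.subsetP SC).
Qed.

(** The combination of the indicators of the members of c with coefficients
    a 0, a 1, and so on. *)
Definition chain_comb c a : RE :=
  \sum_(k < size c) a k *: ind R (nth finset.set0 c k).

Lemma chain_comb1 A : chain_comb [:: A] (fun=> 1) = ind R A.
Proof. by rewrite /chain_comb big_ord1 scale1r. Qed.

Lemma chain_combE c a s :
  chain_comb c a s = \sum_(k < size c) a k * (s \in nth finset.set0 c k)%:R.
Proof. by rewrite sum_ffunE; apply: eq_bigr => k _; rewrite !ffunE. Qed.

Lemma chain_comb_ge0 c a s : (forall k, 0 <= a k) -> 0 <= chain_comb c a s.
Proof.
by move=> a0; rewrite chain_combE sumr_ge0 // => k _; rewrite mulr_ge0.
Qed.

Lemma chain_comb_vanishes c a i :
  is_chain c -> exists2 s, pi s = i & chain_comb c a s = 0.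
Proof.
move=> [sc fc]; have [s] := chain_witness sc (block_neq0 pi_surj i).
rewrite in_block => /eqP ps sA; exists s => //.
rewrite chain_combE big1 // => k _; have Ac := mem_nth finset.set0 (ltn_ord k).
by rewrite sA // (negPf (fc _ Ac i)) mulr0.
Qed.

Lemma reduce_chain c a :
    is_chain c -> (forall k, 0 <= a k) ->
  reduce (chain_comb c a) = chain_comb c a.
Proof.
move=> cc a0; apply: reduce_id => [s|i].
  exact: chain_comb_ge0.
exact: chain_comb_vanishes.
Qed.

Lemma blockmin_chain c a i :
  is_chain c -> (forall k, 0 <= a k) -> blockmin (chain_comb c a) i = 0.
Proof.
move=> cc a0; have [s ps us] := chain_comb_vanishes a i cc.
rewrite (@blockminE _ _ _ _ _ _ s) ?in_block ?ps //.
by move=> t _; rewrite us chain_comb_ge0.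
Qed.

Lemma redmin_chain c a S :
    is_chain c -> (forall k, 0 <= a k) -> S != finset.set0 ->
  redmin S (chain_comb c a) =
    \sum_(k < size c) a k * (S \subset nth finset.set0 c k)%:R.
Proof.
move=> cc a0 S0; have [s sS sc] := chain_witness cc.1 S0.
rewrite (redminE sS) => [|t tS]; rewrite !reduce_chain // !chain_combE.
  by apply: eq_bigr => k _; rewrite sc // mem_nth.
apply: ler_sum => k _; apply: ler_wpM2l => //; rewrite sc ?mem_nth //.
by have [/fintype.subsetP/(_ t tS)->|] := boolP (S \subset _); rewrite ?ler0n.
Qed.

Lemma redmin_ind A S :
  blockfree A -> S != finset.set0 -> redmin S (ind R A) = (S \subset A)%:R.
Proof.
move=> bA S0; rewrite -chain_comb1 redmin_chain //; last exact: is_chain1.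
by rewrite big_ord1 mul1r.
Qed.

Lemma blockmin_ind A i : blockfree A -> blockmin (ind R A) i = 0.
Proof.
by move=> bA; rewrite -chain_comb1 blockmin_chain //; exact: is_chain1.
Qed.

Lemma colored_blockfree A :
  (forall i, (2 <= #|block i|)%N) -> colored pi A -> blockfree A.
Proof.
move=> b2 /forallP cA i; apply/negP => /finset.setIidPr bA.
by have := cA i; rewrite bA leqNgt b2.
Qed.

Lemma colored_subset A S : S \subset A -> colored pi A -> colored pi S.
Proof.
move=> SA /forallP cA; apply/forallP => i.
by apply: leq_trans (cA i); apply/subset_leq_card/finset.setSI.
Qed.

(** The lineality space consists of the vectors constant on each block. *)
Lemma linealityP u :
  u \in lineality R pi <-> exists d : 'I_n -> R, forall s, u s = d (pi s).
Proof.
split=> [/(@coord_span _ _ _ (in_tuple _)) uE|[d ud]].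
  exists (fun i =>
    \sum_k coord (in_tuple [seq ind R (block i) | i <- enum 'I_n]) k u *
           (nth i (enum 'I_n) k == i)%:R) => s.
  rewrite {1}uE sum_ffunE; apply: eq_bigr => k _.
  rewrite ffunE (nth_map (pi s)).
    by rewrite ffunE in_block eq_sym.
  by rewrite -(size_map (fun i => ind R (block i))).
have -> : u = \sum_(i <- enum 'I_n) d i *: ind R (block i).
  apply/ffunP => s; rewrite sum_ffunE big_enum (bigD1 (pi s)) //=.
  rewrite !ffunE in_block eqxx.
  rewrite big1 ?addr0 => [|i /negPf ni]; first by rewrite ud; exact/esym/mulr1.
  by rewrite !ffunE in_block eq_sym ni scaler0.
rewrite big_seq rpred_sum // => i _; rewrite rpredZ //; apply: memv_span.
by apply: (map_f (fun i => ind R (block i))); rewrite mem_enum.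
Qed.

Lemma proj_eq u v :
  proj pi u = proj pi v <->
  exists d : 'I_n -> R, forall s, u s - v s = d (pi s).
Proof.
rewrite /proj clsP; split=> [/linealityP[d ud]|[d ud]].
  by exists d => s; rewrite -ud !ffunE.
by apply/linealityP; exists d => s; rewrite !ffunE.
Qed.

(** A chosen representative of a class. *)
Definition rep (x : NE R pi) : RE := qrepr x.

Lemma repK (y : NE R pi) : proj pi (rep y) = y.
Proof. exact: qreprK. Qed.

Lemma proj_comb (J : Type) (r : seq J) (b : J -> R) (F : J -> RE) :
  proj pi (\sum_(j <- r) b j *: F j) = \sum_(j <- r) b j *: proj pi (F j).
Proof.
rewrite /proj linear_sum; apply: eq_bigr => j _.
exact: linearZ_LR.
Qed.

Lemma proj_chain_comb c a :
  proj pi (chain_comb c a) =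
    \sum_(k < size c) a k *: ray R pi (nth finset.set0 c k).
Proof. exact: proj_comb. Qed.

(** The cone over the images of the indicators of the members of c. *)
Definition chain_cone c : set (NE R pi) :=
  [set y | exists2 a, forall k, 0 <= a k & y = proj pi (chain_comb c a)].

Lemma cone_chain c : cone [seq ray R pi A | A <- c] = chain_cone c.
Proof.
apply/seteqP; split=> y /=.
  move=> /(cone_mapP _ finset.set0)[a a0 ->].
  by exists a; rewrite ?proj_chain_comb.
move=> [a a0 ->]; apply/(cone_mapP _ finset.set0); exists a => //.
by rewrite proj_chain_comb.
Qed.

(** A functional that vanishes on the lineality space is linear on the
    quotient. *)
Lemma descend (w : RE) : (forall i, \sum_(s in block i) w s = 0 :> R) ->
  exists m : {linear NE R pi -> R^o}, forall u, m (proj pi u) = dot w u.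
Proof.
move=> w0.
have inv u v : proj pi u = proj pi v -> dot w u = dot w v.
  move=> /proj_eq[d uv]; apply/eqP; rewrite -subr_eq0 -dotBr; apply/eqP.
  rewrite /dot (partition_big pi predT) //= big1 // => i _.
  rewrite -[RHS](mulr0 (d i)) -[X in _ = _ * X](w0 i) mulr_sumr.
  apply: eq_big => [s|s /eqP ps].
    by rewrite in_block.
  by rewrite !ffunE uv ps mulrC.
pose f : NE R pi -> R^o := fun y => dot w (rep y).
have fl : linear f.
  move=> b y z; rewrite /f.
  have -> : dot w (rep (b *: y + z)) = dot w (b *: rep y + rep z).
    apply: inv; rewrite repK /proj linearP -[X in _ = _ *: X + _]/(proj pi _).
    by rewrite -[X in _ = _ + X]/(proj pi _) !repK.
  exact: (linearP (dot w : RE -> R^o)).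
pose mL := GRing.isLinear.Build R (NE R pi) R^o *:%R f fl.
pose m : {linear NE R pi -> R^o} := HB.pack f mL.
by exists m => u; apply: inv; exact: repK.
Qed.

End Chains.
Arguments rep {R n E pi} x.
Arguments chain_comb {R E} c a.
Arguments chain_cone R {n E} pi c _.

(** * Piecewise linear functions on the colored fan *)

Section PiecewiseLinear.
Variables (R : realType) (n : nat) (E : finType) (pi : E -> 'I_n).
Hypothesis pi_surj : forall i, exists s, pi s = i.
Hypothesis block_ge2 : forall i, (2 <= #|block pi i|)%N.
Local Notation RE := {ffun E -> R^o}.
Local Notation NE := (NE R pi).
Local Notation plfun := (plfun R pi).
Local Notation block := (block pi).
Local Notation blockmin := (blockmin pi).
Local Notation reduce := (reduce pi).
Local Notation redmin := (redmin pi).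
Local Notation is_chain := (is_chain pi).
Local Notation chain_cone := (chain_cone R pi).
Local Notation support := (@fan_support R NE (@colored_fan R n E pi)).
Implicit Types (u v : RE) (y : NE) (S A T : {set E}).
Implicit Types (c : seq {set E}) (a : nat -> R).

(** The chains that index the cones of the colored fan. *)
Definition colored_chain c :=
  sorted (fun A B : {set E} => A \proper B) c /\
  {in c, forall A, A != finset.set0 /\ colored pi A}.

Lemma colored_chain_is_chain c : colored_chain c -> is_chain c.
Proof.
move=> [sc cc]; split; last by move=> A /cc[_]; exact: colored_blockfree.
by apply: sub_sorted sc => A B; exact: proper_sub.
Qed.

Lemma colored_chain1 T :
  T != finset.set0 -> colored pi T -> colored_chain [:: T].
Proof. by move=> T0 cT; split=> // A; rewrite inE => /eqP->. Qed.

Lemma colored_fanP sigma : colored_fan sigma <->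
  exists2 c, colored_chain c & sigma = chain_cone c.
Proof.
split=> [[c [sc cc ->]]|[c [sc cc] ->]]; exists c; first by split.
  by rewrite cone_chain.
by split=> //; rewrite cone_chain.
Qed.

Lemma supportP y : support y <->
  exists2 c, colored_chain c & chain_cone c y.
Proof.
split=> [[sigma /colored_fanP[c cc ->]] ?|[c cc ya]]; first by exists c.
exists (chain_cone c) => //.
  by apply/colored_fanP; exists c.
Qed.

Lemma support_ray T : T != finset.set0 -> colored pi T -> support (ray R pi T).
Proof.
move=> T0 cT; apply/supportP; exists [:: T]; first exact: colored_chain1.
by exists (fun=> 1) => //; rewrite chain_comb1.
Qed.

Lemma pl_chain (phi : plfun) c a : colored_chain c -> (forall k, 0 <= a k) ->
  phi (proj pi (chain_comb c a)) =
    \sum_(k < size c) a k * phi (ray R pi (nth finset.set0 c k)).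
Proof.
move=> cc a0; have /asboolP[lin_phi _] := plvalP phi.
have [m mE] := lin_phi _ (proj2 (colored_fanP _) (ex_intro2 _ _ c cc erefl)).
rewrite mE; last by exists a.
rewrite proj_chain_comb linear_sum; apply: eq_bigr => k _.
rewrite linearZ_LR mE //; exists (fun j : nat => (j == k)%:R) => //.
rewrite proj_chain_comb (bigD1 k) //= eqxx scale1r.
rewrite big1 ?addr0 // => j /negPf jk.
by rewrite -val_eqE /= in jk; rewrite jk scale0r.
Qed.

(** A piecewise linear function is determined by its values on the rays. *)
Lemma pl_ext (phi psi : plfun) :
    (forall T, T != finset.set0 -> colored pi T ->
       phi (ray R pi T) = psi (ray R pi T)) ->
  phi = psi.
Proof.
move=> eq_ray; apply: val_inj; apply/funext => y.
have [/supportP[c cc [a a0 ->]]|ny] := pselect (support y).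
  rewrite /= !pl_chain //; apply: eq_bigr => k _.
  have [T0 cT] := cc.2 _ (mem_nth finset.set0 (ltn_ord k)).
  by congr (_ * _); exact: eq_ray.
have /asboolP[_ /(_ y ny) phi0] := plvalP phi.
have /asboolP[_ /(_ y ny) psi0] := plvalP psi.
by rewrite [LHS]phi0 [RHS]psi0.
Qed.

Lemma redmin_proj S u v : proj pi u = proj pi v -> redmin S u = redmin S v.
Proof. by move=> /proj_eq[d uv]; exact: redmin_shift uv. Qed.

(** Two coordinates in the same block differ by a functional of the quotient. *)
Lemma block_functional s t : pi s = pi t ->
  exists m : {linear NE -> R^o}, forall u, m (proj pi u) = u s - u t.
Proof.
move=> st.
have [i|m mE] := @descend R n E pi (ind R [set s]%SET - ind R [set t]%SET).
  by rewrite -dot_ind dotC dotBr !dot_ind1 !ffunE !in_block st subrr.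
by exists m => u; rewrite mE dotC dotBr !dot_ind1.
Qed.

(** The function redmin S on the support of the colored fan, extended by 0. *)
Definition redmin_fun S : NE -> R^o :=
  fun y => if `[< support y >] then redmin S (rep y) else 0.

Lemma redmin_funE S u :
  support (proj pi u) -> redmin_fun S (proj pi u) = redmin S u.
Proof.
by move=> su; rewrite /redmin_fun asboolT //; apply: redmin_proj; rewrite repK.
Qed.

Lemma redmin_fun_pl S :
  S != finset.set0 -> redmin_fun S \in @pl_pred R n E pi.
Proof.
move=> S0; apply/asboolP; split; last first.
  by move=> y ny; rewrite /redmin_fun asboolF.
move=> _ /colored_fanP[c cc ->].
have [sc bc] := colored_chain_is_chain cc.
have [s sS sA] := chain_witness sc S0.
have [t] := chain_witness sc (block_neq0 pi_surj (pi s)).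
rewrite in_block => /eqP pt tA.
have [m mE] := block_functional (esym pt).
(* On the cone over the chain, redmin S is the coordinate s minus the
   coordinate t, where t lies in the block of s and in no member. *)
exists m => _ [a a0 ->]; rewrite redmin_funE; last first.
  by apply/supportP; exists c => //; exists a.
rewrite mE redmin_chain // !chain_combE.
rewrite [X in _ = _ - X]big1 ?subr0 => [|k _].
  by apply: eq_bigr => k _; rewrite sA ?mem_nth.
by rewrite tA ?mem_nth // (negPf (bc _ (mem_nth _ _) _)) ?mulr0.
Qed.

Lemma fpi_ray S T : S != finset.set0 -> T != finset.set0 -> colored pi T ->
  fpi R pi S (ray R pi T) = (S \subset T)%:R.
Proof.
move=> S0 T0 cT; rewrite /fpi /pl_of_rays.
case: xgetP => [phi _|/(_ (PLFun (redmin_fun_pl S0)))]; first exact.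
case=> A A0 cA /=; rewrite redmin_funE ?redmin_ind //.
  exact: colored_blockfree.
exact: support_ray.
Qed.

Lemma fpi_proj S u : S != finset.set0 -> support (proj pi u) ->
  fpi R pi S (proj pi u) = redmin S u.
Proof.
move=> S0 su; have -> : fpi R pi S = PLFun (redmin_fun_pl S0); last first.
  exact: redmin_funE.
apply: pl_ext => T T0 cT; rewrite fpi_ray //= redmin_funE ?redmin_ind //.
  exact: colored_blockfree.
exact: support_ray.
Qed.

Lemma ellE s : ell R pi s = fpi R pi [set s]%SET.
Proof.
rewrite /ell /fpi; congr pl_of_rays; apply/funext => T.
by rewrite finset.sub1set.
Qed.

Lemma ell_ray s T : T != finset.set0 -> colored pi T ->
  ell R pi s (ray R pi T) = (s \in T)%:R.
Proof.
move=> T0 cT; rewrite ellE fpi_ray ?finset.sub1set //.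
by apply/set0Pn; exists s; rewrite inE.
Qed.

Lemma ell_proj s u : support (proj pi u) -> ell R pi s (proj pi u) = reduce u s.
Proof.
move=> su; rewrite ellE fpi_proj //; last first.
  by apply/set0Pn; exists s; rewrite inE.
by apply: minoverE; rewrite ?inE // => t; rewrite inE => /eqP->.
Qed.

Lemma pl_cls_eq (phi psi : plfun) :
  pl_cls phi = pl_cls psi <->
  exists m : {linear NE -> R^o}, forall y, support y -> phi y - psi y = m y.
Proof.
rewrite /pl_cls clsP; split=> [/asboolP[m mE]|[m mE]]; last apply/asboolP;
  by exists m => y /mE<-.
Qed.

Lemma alphaE s : alpha R pi (pi s) = pl_cls (ell R pi s).
Proof.
rewrite /alpha; case: xgetP => [b _ ->//|/(_ (pl_cls (ell R pi s)))].
case=> t pt.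
apply/pl_cls_eq.
have [m mE] := block_functional pt.
exists m => y sy; rewrite -(repK y) mE !ell_proj ?repK //.
by rewrite !ffunE pt opprB addrA subrK.
Qed.

End PiecewiseLinear.

(** * The barycentric subdivision of the normal fan of a product of simplices *)

Section Barycentric.
Variables (R : realType) (n : nat) (E : finType) (pi : E -> 'I_n).
Hypothesis pi_surj : forall i, exists s, pi s = i.
Hypothesis block_ge2 : forall i, (2 <= #|block pi i|)%N.
Local Notation RE := {ffun E -> R^o}.
Local Notation NE := (NE R pi).
Local Notation block := (block pi).
Local Notation blockmin := (blockmin pi).
Local Notation reduce := (reduce pi).
Local Notation redmin := (redmin pi).
Local Notation is_chain := (is_chain pi).
Local Notation chain_cone := (chain_cone R pi).
Local Notation blockfree := (blockfree pi).
Local Notation Delta := (Delta R pi).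
Local Notation ncone := (@normal_cone R n E pi).
Implicit Types (u v w x : RE) (y : NE) (S A B T : {set E}).
Implicit Types (c : seq {set E}) (a : nat -> R).

Lemma colored1 s : colored pi [set s]%SET.
Proof.
apply/forallP => i.
by rewrite (leq_trans (subset_leq_card (finset.subsetIl _ _))) ?cards1.
Qed.

Lemma blockfree1 s : blockfree [set s]%SET.
Proof. exact/colored_blockfree/colored1. Qed.

Lemma reduce_ind A : blockfree A -> reduce (ind R A) = ind R A.
Proof.
by move=> bA; rewrite -chain_comb1 reduce_chain //; exact: is_chain1.
Qed.

Lemma proj_reduce u : proj pi (reduce u) = proj pi u.
Proof.
apply/proj_eq; exists (fun i => - blockmin u i) => s.
by rewrite ffunE addrAC subrr sub0r.
Qed.

Lemma reduce_proj u v : proj pi u = proj pi v -> reduce u = reduce v.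
Proof. by move=> /proj_eq[d uv]; exact: reduce_shift uv. Qed.

(** The support of a reduced vector u contains no block. Subtracting the minimal
    positive value of u times the indicator of the support shrinks the support,
    which becomes the last member of the chain. *)
Lemma chain_decomposition u :
    (forall s, 0 <= u s) -> (forall i, exists2 s, pi s = i & u s = 0) ->
  exists c, [/\ sorted (fun A B : {set E} => A \proper B) c,
     {in c, forall A, [/\ A != finset.set0, blockfree A
                        & A \subset [set s | u s != 0]%SET]}
   & exists2 a : nat -> R, forall k, 0 <= a k & u = chain_comb c a].
Proof.
have [N] := ubnP #|[set s | u s != 0]%SET|; elim: N u => // N IH u.
set B := [set s | u s != 0]%SET; rewrite ltnS => leBN u0 uz.
have [B0|B0] := eqVneq B finset.set0.
  exists [::]; split=> //; exists (fun=> 0) => //; apply/ffunP => s.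
  rewrite chain_combE big_ord0; apply/eqP; apply: contraT => us.
  by have : s \in B by [rewrite inE]; rewrite B0 inE.
have [r rB ur] := minover_ex u B0; set m := minover B u in ur.
have bB : blockfree B.
  move=> i; apply/negP => /fintype.subsetP iB; have [s ps us] := uz i.
  by have := iB s; rewrite in_block ps eqxx inE us eqxx => /(_ isT).
pose v : RE := u - m *: ind R B.
have vE s : v s = u s - m * (s \in B)%:R by rewrite !ffunE.
have vB : [set s | v s != 0]%SET \proper B.
  rewrite properE; apply/andP; split.
    apply/fintype.subsetP => s; rewrite inE vE; apply: contraR => sB.
    by rewrite (negPf sB) mulr0 subr0; move: sB; rewrite inE negbK.
  by apply/subsetPn; exists r => //; rewrite inE vE rB mulr1 ur subrr eqxx.
have [|s|i|c [sc cP [a a0 va]]] := IH v.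
- exact: leq_trans (proper_card vB) leBN.
- rewrite vE; have [sB|_] := boolP (s \in B); last by rewrite mulr0 subr0.
  by rewrite mulr1 subr_ge0 minover_le.
- have [s ps us] := uz i; exists s => //.
  by rewrite vE [s \in B]inE us eqxx mulr0 subr0.
exists (rcons c B); split.
- case: c sc cP {va} => //= A c sc cP; rewrite rcons_path sc /=.
  have [|_ _ lv] := cP (last A c); first by rewrite mem_last.
  exact: sub_proper_trans lv vB.
- move=> A; rewrite mem_rcons inE => /orP[/eqP->|/cP[A0 bA Av]].
    by split.
  by split=> //; apply: fintype.subset_trans Av (proper_sub vB).
exists (fun k => if (k < size c)%N then a k else m) => [k|].
  by case: ifP => // _; rewrite -ur.
apply/ffunP => s; rewrite chain_combE size_rcons big_ord_recr /= ltnn.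
rewrite nth_rcons ltnn eqxx -[LHS](subrK (m * (s \in B)%:R)) -vE va.
congr (_ + _); rewrite chain_combE; apply: eq_bigr => k _.
by rewrite ltn_ord nth_rcons ltn_ord.
Qed.

(** The face on which u is minimal consists of the points supported on the zeros
    of the reduction of u. *)
Lemma face_DeltaE u x : face Delta u x <-> Delta x /\ dot (reduce u) x = 0.
Proof.
have minD := prod_simplex_is_minimum pi_surj [set: 'I_n] u.
split=> [[Dx ux]|[Dx ux]]; split=> //.
  case: minD => [[z Dz zm] lb]; have := dot_reduce Dx u.
  rewrite -[\sum_s _]/(dot (reduce u) x) => dx.
  have : dot u x = \sum_(i in [set: 'I_n]%SET) blockmin u i.
    by apply/eqP; rewrite eq_le lb // andbT -zm; exact: ux.
  by rewrite dx => /eqP; rewrite addrC -subr_eq0 addrK => /eqP.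
move=> z Dz; rewrite (dot_reduce Dx u) -[\sum_s _]/(dot (reduce u) x) ux addr0.
exact: minD.2.
Qed.

Lemma face_Delta_proj u v :
  proj pi u = proj pi v -> face Delta u = face Delta v.
Proof.
move=> uv; apply/seteqP; split=> x /face_DeltaE ux; apply/face_DeltaE.
  by rewrite -(reduce_proj uv).
by rewrite (reduce_proj uv).
Qed.

Lemma ncone_DeltaE w v :
  ncone Delta w (proj pi v) <-> face Delta w `<=` face Delta v.
Proof.
split=> [[u /= wu uv]|wv]; last by exists v.
by rewrite -(face_Delta_proj uv).
Qed.

Lemma face_Delta_ind A x : blockfree A ->
  face Delta (ind R A) x <-> Delta x /\ {in A, forall s, x s = 0}.
Proof.
move=> bA; split=> [/face_DeltaE|] [Dx xA]; last apply/face_DeltaE; split=> //.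
  move: xA; rewrite reduce_ind // dotC dot_ind => /eqP.
  rewrite psumr_eq0 => [/allP xA s sA|s _]; last exact: (prod_simplex_ge0 Dx).
  by have := xA s (mem_index_enum s); rewrite sA => /eqP.
by rewrite reduce_ind // dotC dot_ind big1.
Qed.

(** The elements s whose ray lies in sigma, i.e. those whose rays are summed in
    the barycenter of sigma. *)
Definition rayset (sigma : set NE) : {set E} :=
  [set s | ray R pi [set s]%SET \in sigma]%SET.

Lemma mem_rayset (sigma : set NE) s :
  (s \in rayset sigma) <-> sigma (ray R pi [set s]%SET).
Proof. by rewrite inE in_setE. Qed.

Lemma indE A : ind R A = \sum_(s in A) ind R [set s]%SET.
Proof.
apply/ffunP => r; rewrite sum_ffunE ffunE.
have [rA|rA] := boolP (r \in A).
  rewrite (bigD1 r) //= ffunE inE eqxx big1 ?addr0 // => s /andP[_ sr].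
  by rewrite ffunE inE eq_sym (negPf sr).
rewrite big1 // => s sA; rewrite ffunE inE.
by case: eqP rA => // ->; rewrite sA.
Qed.

Lemma barycenterE (sigma : set NE) : barycenter sigma = ray R pi (rayset sigma).
Proof.
rewrite /ray indE /proj linear_sum; apply: eq_bigl => s.
by rewrite [in RHS]inE.
Qed.

Lemma rayset_mono (sigma tau : set NE) :
  sigma `<=` tau -> rayset sigma \subset rayset tau.
Proof.
move=> st; apply/fintype.subsetP => s /mem_rayset sx.
apply/mem_rayset; exact: st.
Qed.

(** A point of the face of w has total weight 1 on each block, but would vanish
    on a block whose rays all lie in the normal cone. *)
Lemma rayset_blockfree w : blockfree (rayset (ncone Delta w)).
Proof.
move=> i; apply/negP => /fintype.subsetP iw.
have [[x Dx xm] lb] := prod_simplex_is_minimum pi_surj [set: 'I_n] w.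
have fx : face Delta w x by split=> // z Dz; rewrite xm; exact: lb.
have := prod_simplex_sum Dx (i := i) (finset.in_setT _).
rewrite big1 => [/esym/eqP|s /iw/mem_rayset/ncone_DeltaE/(_ _ fx)].
  by rewrite oner_eq0.
move=> /(face_Delta_ind _ (@blockfree1 s))[_]; apply; exact: finset.set11.
Qed.

(** For s outside A, a vertex avoiding A and containing s is minimal for the
    indicator of A but not for that of s. *)
Lemma rayset_ind A : blockfree A -> rayset (ncone Delta (ind R A)) = A.
Proof.
move=> bA; apply/setP => s; apply/idP/idP => [/mem_rayset/ncone_DeltaE sf|sA].
  apply: contraT => sA.
  have tP i : exists2 t, pi t = i & t \notin A.
    have /subsetPn[t tB tA] := bA i; exists t => //.
    by apply/eqP; rewrite -in_block.
  have [t pt tA] := fin_all_exists2 tP.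
  pose t' i := if i == pi s then s else t i.
  have pt' i : pi (t' i) = i by rewrite /t'; case: eqP => [->|].
  have Dt := vertex_prod_simplex R [set: 'I_n] pt'.
  pose x := vertex R [set: 'I_n] t'.
  have t'A i : t' i \notin A by rewrite /t'; case: eqP.
  have : face Delta (ind R A) x.
    apply/face_Delta_ind => //; split=> // r rA.
    rewrite sum_ffunE big1 // => i _; rewrite ffunE inE.
    by case: eqP rA => // ->; rewrite (negPf (t'A i)).
  move=> /sf/(face_Delta_ind _ (@blockfree1 s))[_ /(_ s (finset.set11 s))/eqP].
  rewrite sum_ffunE psumr_eq0 => [/allP/(_ (pi s))|i _]; last first.
    by rewrite ffunE ler0n.
  rewrite mem_index_enum ffunE inE /t' !eqxx oner_eq0.
  by move=> /(_ isT)/implyP/(_ (finset.in_setT _)).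
apply/mem_rayset/ncone_DeltaE => x /(face_Delta_ind _ bA)[Dx xA].
apply/face_Delta_ind; first exact: blockfree1.
by split=> // r; rewrite inE => /eqP->; exact: xA.
Qed.

Lemma ncone_ind_mono A B : blockfree A -> blockfree B -> A \proper B ->
  ncone Delta (ind R A) `<` ncone Delta (ind R B).
Proof.
move=> bA bB AB; split=> [y [u /= Au uy]|BA].
  exists u => //= x /(face_Delta_ind _ bB)[Dx xB].
  apply/Au/face_Delta_ind => //.
  by split=> // s sA; apply: xB; exact: fintype.subsetP (proper_sub AB) _ sA.
have := rayset_mono BA; rewrite !rayset_ind // => BsA.
by move: AB; rewrite properE BsA andbF.
Qed.

Lemma ncone_ind_neq0 A : blockfree A -> A != finset.set0 ->
  ncone Delta (ind R A) <> [set 0].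
Proof.
move=> bA /set0Pn[s]; rewrite -{1}(rayset_ind bA) => /mem_rayset + A0.
rewrite A0 /= => s0.
have : reduce (ind R [set s]%SET) = reduce (ind R finset.set0).
  apply: reduce_proj; rewrite -[LHS]/(ray R pi [set s]%SET) s0; symmetry.
  rewrite /proj (_ : ind R _ = 0) ?raddf0 //.
  by apply/ffunP => r; rewrite !ffunE inE.
have b0 : blockfree finset.set0 by move=> i; rewrite finset.subset0 block_neq0.
rewrite (reduce_ind (@blockfree1 s)) (reduce_ind b0) => /ffunP/(_ s)/eqP.
by rewrite !ffunE finset.set11 finset.in_set0 oner_eq0.
Qed.

Lemma barycentric_complete :
  fan_support (barycentric (normal_fan Delta)) = [set: NE].
Proof.
apply/seteqP; split=> // y _.
have [||c [sc cP [a a0 ua]]] := @chain_decomposition (reduce (rep y)).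
- exact: reduce_ge0.
- exact: reduce_vanishes.
have bP : {in c, forall A, blockfree A} by move=> A /cP[].
exists (cone [seq ray R pi A | A <- c]).
  exists [seq ncone Delta (ind R A) | A <- c]; split.
  - rewrite sorted_map; move: sc.
    apply: (sub_in_sorted (P := mem c)) => [A B Ac Bc AB|].
      by apply/asboolP/ncone_ind_mono => //; exact: bP.
    exact/allP.
  - move=> sigma /mapP[A /cP[A0 bA _] ->]; split; first by exists (ind R A).
    exact: ncone_ind_neq0.
  - congr cone; rewrite -map_comp; apply/eq_in_map => A Ac /=.
    by rewrite barycenterE rayset_ind //; exact: bP.
apply/(cone_mapP _ finset.set0); exists a => //.
by rewrite -proj_chain_comb -ua proj_reduce repK.
Qed.

(** Each cone of the subdivision is spanned by the indicators of a chain. *)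
Lemma barycentric_chain (tau : set NE) : barycentric (normal_fan Delta) tau ->
  exists2 c, is_chain c & tau = chain_cone c.
Proof.
move=> [cs [scs csP ->]]; exists [seq rayset sigma | sigma <- cs].
  split=> [|A /mapP[sigma /csP[[w _ <-] _] ->]]; last exact: rayset_blockfree.
  rewrite sorted_map; apply: sub_sorted scs => sigma rho /asboolP[sr _].
  exact: rayset_mono.
rewrite -cone_chain -map_comp; congr cone.
by apply: eq_map => sigma; rewrite barycenterE.
Qed.

(** When the minimum support function H of a polytope is additive on the cones
    over chains, the normal fan of the polytope coarsens the subdivision, so a
    class represented by - H is nef. *)
Lemma nef_conv (vs : seq RE) (H : RE -> R) (b : plclass R pi) :
    vs != [::] -> (forall u, is_minimum (conv vs) u (H u)) ->
    (forall c a, is_chain c -> (forall k, 0 <= a k) ->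
       H (chain_comb c a) =
         \sum_(k < size c) a k * H (ind R (nth finset.set0 c k))) ->
    represents (fun u => - H u) b ->
  nef b.
Proof.
move=> vs0 minH addH repH; exists (conv vs); split; first by exists vs.
  split=> [|tau /barycentric_chain[c cc ->]].
    rewrite barycentric_complete; apply/seteqP; split=> // y _.
    exists (ncone (conv vs) (rep y)); first by exists (rep y).
    by exists (rep y) => //; exact: repK.
  (* w lies in the relative interior of the cone, so a minimizer of w over the
     polytope minimizes each indicator of the chain. *)
  pose w := chain_comb c (fun=> 1 : R).
  exists (ncone (conv vs) w) => [|y [a a0 ->]]; first by exists w.
  exists (chain_comb c a) => //= x [Qx wx]; split=> //.
  have lb k :
      H (ind R (nth finset.set0 c k)) <= dot (ind R (nth finset.set0 c k)) x.
    exact: (minH _).2.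
  have xH k : (k < size c)%N ->
      dot (ind R (nth finset.set0 c k)) x = H (ind R (nth finset.set0 c k)).
    have : dot w x = H w.
      have [[z Qz zH] lbw] := minH w.
      by apply/eqP; rewrite eq_le lbw // andbT -zH; exact: wx.
    rewrite addH // /w dot_combl => /eqP; rewrite -subr_eq0 -sumrB.
    rewrite psumr_eq0 => [/allP xk lt_k|j _]; last by rewrite !mul1r subr_ge0.
    have := xk (Ordinal lt_k) (mem_index_enum _).
    by rewrite /= !mul1r subr_eq0 => /eqP.
  move=> z Qz; apply: le_trans ((minH (chain_comb c a)).2 _ Qz).
  rewrite addH // dot_combl; apply: ler_sum => k _.
  by rewrite xH.
have [phi rphi cphi] := repH; exists phi => // u su.
by rewrite (hmax_opp (minH u)) rphi.
Qed.
End Barycentric.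

(** * Representability and nefness of the family *)

Section NefBasis.
Variables (R : realType) (n : nat) (E : finType) (pi : E -> 'I_n).
Hypothesis pi_surj : forall i, exists s, pi s = i.
Hypothesis block_ge2 : forall i, (2 <= #|block pi i|)%N.
Local Notation RE := {ffun E -> R^o}.
Local Notation NE := (NE R pi).
Local Notation plfun := (plfun R pi).
Local Notation plclass := (plclass R pi).
Local Notation block := (block pi).
Local Notation blockmin := (blockmin pi).
Local Notation reduce := (reduce pi).
Local Notation redmin := (redmin pi).
Local Notation is_chain := (is_chain pi).
Local Notation chain_cone := (chain_cone R pi).
Local Notation support_idx := (support_idx pi).
Local Notation colored := (colored pi).
Local Notation alpha := (alpha R pi).
Local Notation fpi := (fpi R pi).
Local Notation ell := (ell R pi).
Implicit Types (u v : RE) (y : NE) (S A T : {set E}).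
Implicit Types (c : seq {set E}) (a : nat -> R).

Lemma plvalB (phi psi : plfun) y : (phi - psi) y = phi y - psi y.
Proof. by []. Qed.

Lemma plvalZ (b : R) (phi : plfun) y : (b *: phi) y = b * phi y.
Proof. by []. Qed.

Lemma plval_sum (J : Type) (r : seq J) (P : pred J) (F : J -> plfun) y :
  (\sum_(j <- r | P j) F j) y = \sum_(j <- r | P j) F j y.
Proof. by elim/big_rec2: _ => // j _ phi _ <-. Qed.

Lemma plval_comb (J : Type) (r : seq J) (P : pred J) (b : J -> R)
    (F : J -> plfun) y :
  (\sum_(j <- r | P j) b j *: F j) y = \sum_(j <- r | P j) b j * F j y.
Proof. by rewrite plval_sum; apply: eq_bigr => j _; rewrite plvalZ. Qed.

Lemma pl_clsB (phi psi : plfun) : pl_cls (phi - psi) = pl_cls phi - pl_cls psi.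
Proof. exact: clsB. Qed.

Lemma pl_cls_sum (J : Type) (r : seq J) (P : pred J) (F : J -> plfun) :
  pl_cls (\sum_(j <- r | P j) F j) = \sum_(j <- r | P j) pl_cls (F j).
Proof. exact: linear_sum. Qed.

Lemma pl_clsZ (b : R) (phi : plfun) : pl_cls (b *: phi) = b *: pl_cls phi.
Proof. exact: linearZ_LR. Qed.

(** A colored set meets each of its blocks in one element. *)
Lemma sum_support_idx (V : nmodType) S (F : 'I_n -> V) : colored S ->
  \sum_(i in support_idx S) F i = \sum_(s in S) F (pi s).
Proof.
move=> /forallP cS; have -> : support_idx S = [set pi s | s in S]%SET.
  apply/setP => i; apply/idP/imsetP => [|[s sS ->]]; last first.
    exact: mem_support_idx.
  rewrite inE => /set0Pn[s]; rewrite finset.in_setI in_block.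
  by move=> /andP[sS /eqP ps]; exists s.
rewrite big_imset //= => s t sS tS st; apply/eqP.
have /card_le1P/(_ s) := cS (pi s); rewrite finset.in_setI sS in_block eqxx.
by move=> /(_ isT t); rewrite finset.in_setI tS in_block st eqxx inE eq_sym.
Qed.

Lemma represents_alpha s :
  represents (fun u => u s - blockmin u (pi s)) (alpha (pi s)).
Proof.
exists (ell s); last by rewrite alphaE.
by move=> u su; rewrite ell_proj // ffunE.
Qed.

Lemma represents_trunc S : S != finset.set0 -> colored S ->
  represents (fun u => dot u (ind R S) -
     (\sum_(i in support_idx S) blockmin u i + redmin S u))
    (\sum_(i in support_idx S) alpha i - pl_cls (fpi S)).
Proof.
move=> S0 cS; exists (\sum_(s in S) ell s - fpi S).
  move=> u su; rewrite plvalB plval_sum fpi_proj // sum_support_idx // dot_ind.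
  rewrite opprD addrA -sumrB; congr (_ - _); apply: eq_bigr => s _.
  by rewrite ell_proj // ffunE.
rewrite pl_clsB pl_cls_sum sum_support_idx //; congr (_ - _).
by apply: eq_bigr => s _; rewrite alphaE.
Qed.

Lemma simplex_is_minimum i u :
  is_minimum (simplex R (block i)) u (blockmin u i).
Proof.
have [s sB us] := minover_ex u (block_neq0 pi_surj i).
apply: conv_is_minimum => [|_ /mapP[t tB ->]].
  exists (ind R [set s]%SET); last by rewrite dot_ind1.
  by apply: (map_f (fun s => ind R [set s]%SET)); rewrite mem_enum.
by rewrite dot_ind1 minover_le // -mem_enum.
Qed.

Lemma nef_alpha i : nef (alpha i).
Proof.
have [s ps] := pi_surj i; rewrite -ps.
pose vs : seq RE :=
  [seq ind R [set t]%SET - ind R [set s]%SET | t <- enum (block (pi s))].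
apply: (@nef_conv _ _ _ _ pi_surj block_ge2 vs
          (fun u => blockmin u (pi s) - u s)).
- by rewrite -size_eq0 size_map -cardE cards_eq0 block_neq0.
- move=> u; have [t tB ut] := minover_ex u (block_neq0 pi_surj (pi s)).
  apply: conv_is_minimum => [|_ /mapP[r rB ->]].
    exists (ind R [set t]%SET - ind R [set s]%SET); last first.
      by rewrite dotBr !dot_ind1 ut.
    by apply: (map_f (fun t => ind R [set t]%SET - _)); rewrite mem_enum.
  by rewrite dotBr !dot_ind1 lerD2r minover_le // -mem_enum.
- move=> c a cc a0; rewrite blockmin_chain // chain_combE sub0r -sumrN.
  apply: eq_bigr => k _; rewrite blockmin_ind //; last exact/cc.2/mem_nth.
  by rewrite sub0r ffunE mulrN.
- rewrite (_ : (fun u => _) = (fun u => u s - blockmin u (pi s))).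
    exact: represents_alpha.
  by apply/funext => u; rewrite opprB.
Qed.

(** The polytope is the convex hull of the translated vertices that meet S; it
    has the same support function as the translated truncation, which is all
    that is needed. *)
Lemma nef_trunc S : S != finset.set0 -> colored S ->
  nef (\sum_(i in support_idx S) alpha i - pl_cls (fpi S)).
Proof.
move=> S0 cS.
pose meets (t : {ffun 'I_n -> E}) :=
  [forall i, pi (t i) == i] && [exists i in support_idx S, t i \in S].
pose vs : seq RE := [seq vertex R (support_idx S) t - ind R S
                    | t : {ffun 'I_n -> E} <- enum meets].
have opt u : exists2 v, v \in vs & dot u v =
    \sum_(i in support_idx S) blockmin u i + redmin S u - dot u (ind R S).
  have [t [pt [i iS ti] ut]] :=
    optimal_vertex pi_surj u S0 (fintype.subxx (support_idx S)).
  exists (vertex R (support_idx S) [ffun i => t i] - ind R S).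
    apply: (map_f (fun t : {ffun _} => vertex R (support_idx S) t - _)).
    rewrite mem_enum; apply/andP; split.
      by apply/forallP => j; rewrite ffunE pt.
    by apply/existsP; exists i; rewrite iS ffunE.
  rewrite dotBr -ut; congr (dot u _ - _).
  by apply: eq_bigr => j _; rewrite ffunE.
apply: (@nef_conv _ _ _ _ pi_surj block_ge2 vs (fun u =>
   \sum_(i in support_idx S) blockmin u i + redmin S u - dot u (ind R S))).
- by have [v] := opt 0; case: (vs).
- move=> u; apply: conv_is_minimum; first exact: opt.
  move=> _ /mapP[t + ->]; rewrite mem_enum.
  move=> /andP[/forallP pt /existsP[i /andP[iS tS]]].
  rewrite dotBr lerD2r.
  have := DTr_is_minimum pi_surj u S0 (fintype.subxx (support_idx S)).
  case=> _; apply; apply: vertex_DTr iS tS => // j; exact/eqP/pt.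
- move=> c a cc a0; rewrite big1 ?add0r => [|i _]; last exact: blockmin_chain.
  rewrite redmin_chain // dot_combl -sumrB; apply: eq_bigr => k _.
  have bk : blockfree pi (nth finset.set0 c k) by exact/cc.2/mem_nth.
  rewrite big1 ?add0r => [|i _]; last exact: blockmin_ind.
  by rewrite redmin_ind // mulrBr.
- rewrite (_ : (fun u => _) = (fun u => dot u (ind R S) -
     (\sum_(i in support_idx S) blockmin u i + redmin S u))).
    exact: represents_trunc.
  by apply/funext => u; rewrite opprB.
Qed.

(** Moebius inversion on nonempty sets, constructed by induction on the size. *)
Lemma subset_expansion (v : {set E} -> R) : exists a : {set E} -> R,
  forall T, T != finset.set0 ->
    v T = \sum_(S | (S != finset.set0) && (S \subset T)) a S.
Proof.
suff [a aP] : exists a : {set E} -> R,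
    forall T, (#|T| <= #|E|)%N -> T != finset.set0 ->
    v T = \sum_(S | (S != finset.set0) && (S \subset T)) a S.
  by exists a => T; apply: aP; exact: max_card.
elim: #|E| => [|N [a aP]].
  by exists (fun=> 0) => T; rewrite leqn0 cards_eq0 => /eqP->; rewrite eqxx.
pose a' T := if #|T| == N.+1 then
  v T - \sum_(S | [&& S != finset.set0, S \subset T & S != T]) a S else a T.
exists a' => T leT T0; have [TN|TN] := eqVneq #|T| N.+1.
  rewrite (bigD1 T) /= ?T0 ?fintype.subxx // {1}/a' TN eqxx.
  set rest := \sum_(S | [&& _, _ & _]) a S.
  rewrite -[LHS](subrK rest); congr (_ + _).
  apply: eq_big => [S|S /and3P[_ ST SneT]]; first by rewrite -andbA.
  rewrite /a'; case: eqP => // SN.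
  by move: SneT; rewrite eqEcard ST TN SN leqnn.
have {}leT : (#|T| <= N)%N by rewrite -ltnS ltn_neqAle TN leT.
rewrite aP //; apply: eq_bigr => S /andP[_ ST]; rewrite /a'.
case: eqP => // SN; have := leq_trans (subset_leq_card ST) leT.
by rewrite SN ltnn.
Qed.

(** Nonempty subsets of a colored set are colored, so the inversion can be done
    within the colored sets. *)
Lemma pl_expansion (phi : plfun) : exists a : {set E} -> R,
  phi = \sum_(S | (S != finset.set0) && colored S) a S *: fpi S.
Proof.
have [a aP] := subset_expansion (fun T => phi (ray R pi T)); exists a.
apply: pl_ext => // T T0 cT; rewrite aP // plval_comb.
rewrite [RHS](bigID (fun S => S \subset T)) /= [X in _ + X]big1 ?addr0.
  apply: eq_big => [S|S /andP[S0 ST]]; last by rewrite fpi_ray // ST mulr1.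
  have [ST|] := boolP (S \subset T); last by rewrite !andbF.
  by rewrite (colored_subset ST cT) !andbT.
by move=> S /andP[/andP[S0 _] /negPf ST]; rewrite fpi_ray // ST mulr0.
Qed.

End NefBasis.

(** * The family is a basis *)

Section Basis.
Variables (R : realType) (n : nat) (E : finType) (pi : E -> 'I_n).
Hypothesis pi_surj : forall i, exists s, pi s = i.
Hypothesis block_ge2 : forall i, (2 <= #|block pi i|)%N.
Local Notation plfun := (plfun R pi).
Local Notation block := (block pi).
Local Notation support_idx := (support_idx pi).
Local Notation colored := (colored pi).
Local Notation alpha := (alpha R pi).
Local Notation fpi := (fpi R pi).
Local Notation ell := (ell R pi).
Implicit Types (S A T : {set E}).

Local Notation big_colored S := (colored S && (1 < #|S|)%N).
Local Notation index := ('I_n + {S : {set E} | big_colored S})%type.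

Lemma big_colored_neq0 S : big_colored S -> S != finset.set0.
Proof. by case/andP=> _ S1; rewrite -card_gt0; apply: leq_trans S1. Qed.

(** The member of the family attached to S; it makes sense for every colored S
    and vanishes on singletons. *)
Definition trunc_class S :=
  \sum_(i in support_idx S) alpha i - pl_cls (fpi S).

(** The coefficient of d at S, with the value 0 if S is not colored with at
    least two elements. *)
Definition coef (d : index -> R) S : R :=
  if insub S is Some A then d (inr A) else 0.

Lemma sum_nef_family (d : index -> R) :
  \sum_k d k *: nef_family R pi k =
    \sum_i d (inl i) *: alpha i +
    \sum_(S | big_colored S) coef d S *: trunc_class S.
Proof.
rewrite big_sumType /=; congr (_ + _).
rewrite [RHS](reindex_omap (val : {S | big_colored S} -> _) insub) => [|S bS].
  by apply: eq_big => [A|A _]; rewrite ?valK ?eqxx ?(valP A) // /coef valK.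
by rewrite insubT.
Qed.

Lemma trunc_class1 S : S != finset.set0 -> colored S -> ~~ big_colored S ->
  trunc_class S = 0.
Proof.
move=> S0 cS; rewrite cS /= -leqNgt => S1.
have /cards1P[s Ss] : #|S| == 1%N by rewrite eqn_leq S1 card_gt0.
by rewrite /trunc_class sum_support_idx // Ss big_set1 alphaE // ellE subrr.
Qed.

Lemma nef_family_spans (v : plclass R pi) :
  exists c : {ffun index -> R}, v = \sum_k c k *: nef_family R pi k.
Proof.
pose nonempty S := (S != finset.set0) && colored S.
have [a vE] := pl_expansion pi_surj block_ge2 (qrepr v).
pose b i := \sum_(S | nonempty S && (i \in support_idx S)) a S.
pose d (k : index) := match k with inl i => b i | inr A => - a (val A) end.
exists [ffun k => d k].
rewrite (eq_bigr (fun k => d k *: nef_family R pi k)) => [|k _]; last first.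
  by rewrite ffunE.
rewrite sum_nef_family /= -[LHS]qreprK -[LHS]/(pl_cls (qrepr v)) vE pl_cls_sum.
transitivity (\sum_(S | nonempty S)
   (a S *: \sum_(i in support_idx S) alpha i - a S *: trunc_class S)).
  by apply: eq_bigr => S _; rewrite pl_clsZ -scalerBr opprB addrC subrK.
rewrite sumrB; congr (_ + _).
  rewrite (eq_bigr (fun S => \sum_(i in support_idx S) a S *: alpha i));
    last by move=> S _; exact: scaler_sumr.
  rewrite (exchange_big_dep predT) //=; apply: eq_bigr => i _.
  by rewrite scaler_suml.
rewrite -sumrN (bigID (fun S => big_colored S)) /= [X in _ + X]big1 ?addr0.
  apply: eq_big => [S|S /andP[_ bS]].
    have [bS|] := boolP (big_colored S); last by rewrite andbF.
    by rewrite /nonempty big_colored_neq0 //; case/andP: bS => ->.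
  by rewrite /coef insubT scaleNr.
by move=> S /andP[/andP[S0 cS] bS]; rewrite trunc_class1 // scaler0 oppr0.
Qed.

(** In the proof, e i and coef d S are the coefficients after the family is
    rewritten in terms of the alpha i and the classes of the fpi S. *)
Lemma nef_family_free (d : index -> R) :
  \sum_k d k *: nef_family R pi k = 0 -> forall k, d k = 0.
Proof.
rewrite sum_nef_family => d0.
have [t pt] := fin_all_exists pi_surj.
pose e i := d (inl i) +
  \sum_(S | big_colored S && (i \in support_idx S)) coef d S.
pose phi : plfun :=
  \sum_i e i *: ell (t i) - \sum_(S | big_colored S) coef d S *: fpi S.
have [m mE] : exists m : {linear NE R pi -> R^o},
    forall y, fan_support (@colored_fan R n E pi) y ->
      phi y - (0 : plfun) y = m y.
  apply/pl_cls_eq; rewrite [RHS]linear0 -[RHS]d0 pl_clsB !pl_cls_sum.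
  under eq_bigr do rewrite pl_clsZ -alphaE // pt scalerDl scaler_suml.
  rewrite big_split /= -addrA; congr (_ + _).
  rewrite (exchange_big_dep (fun S => big_colored S)) /= => [|i S _ /andP[]//].
  rewrite -sumrB; apply: eq_bigr => S bS.
  rewrite pl_clsZ -scaler_sumr -scalerBr; congr (_ *: (_ - _)).
  by apply: eq_bigl => i; rewrite bS.
have {}mE T : T != finset.set0 -> colored T -> m (ray R pi T) =
    \sum_i e i * (t i \in T)%:R -
    \sum_(S | big_colored S) coef d S * (S \subset T)%:R.
  move=> T0 cT; rewrite -mE; last exact: support_ray.
  rewrite subr0 plvalB !plval_comb; congr (_ - _); apply: eq_bigr => S.
    by rewrite ell_ray.
  by move=> /big_colored_neq0 S0; rewrite fpi_ray.
have m_add T : m (ray R pi T) = \sum_(s in T) m (ray R pi [set s]%SET).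
  by rewrite {1}/ray indE /proj !linear_sum.
have m1 s : m (ray R pi [set s]%SET) = \sum_i e i * (t i == s)%:R.
  rewrite mE; last 2 first.
  - by apply/set0Pn; exists s; rewrite inE.
  - exact: colored1.
  rewrite [X in _ - X]big1 ?subr0 => [|S /andP[_ S1]].
    by apply: eq_bigr => i _; rewrite inE.
  have [/subset_leq_card|] := boolP (S \subset _); last by rewrite mulr0.
  by rewrite cards1 leqNgt S1.
(* m is additive in the elements of T and so is the first sum of mE; hence the
   second one vanishes. *)
have sumf0 T : T != finset.set0 -> colored T ->
    \sum_(S | big_colored S) coef d S * (S \subset T)%:R = 0.
  move=> T0 cT; have := m_add T; rewrite mE // (eq_bigr _ (fun s _ => m1 s)).
  rewrite exchange_big /= => /eqP.
  rewrite subr_eq -{1}[X in X == _]addr0 => /eqP.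
  rewrite (eq_bigr (fun i => \sum_(s in T) e i * (t i == s)%:R)).
    by move=> /addrI.
  move=> i _; rewrite -mulr_sumr; congr (_ * _).
  have [tT|tT] := boolP (t i \in T).
    rewrite (bigD1 (t i)) //= eqxx big1 ?addr0 // => s /andP[_].
    by rewrite eq_sym => /negPf->.
  by rewrite big1 // => s sT; case: eqP tT => // ->; rewrite sT.
have coef0 S : big_colored S -> coef d S = 0.
  have [N] := ubnP #|S|; elim: N S => // N IH S; rewrite ltnS => leSN bS.
  have := sumf0 S (big_colored_neq0 bS).
  rewrite (bigD1 S) //= fintype.subxx mulr1.
  rewrite big1 ?addr0 => [|A /andP[bA AS]].
    by case/andP: bS => cS _; apply.
  have [sAS|] := boolP (A \subset S); last by rewrite mulr0.
  rewrite IH ?mul0r //; apply: leq_trans leSN; apply: proper_card.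
  by rewrite finset.properEneq AS.
case=> [j|A]; last first.
  by have := coef0 (val A) (valP A); rewrite /coef valK.
have eE i : e i = d (inl i).
  by rewrite /e big1 ?addr0 // => S /andP[bS _]; exact: coef0.
(* The rays of the elements of a block sum to 0 in the quotient. *)
have := m_add (block j).
have -> : ray R pi (block j) = 0.
  rewrite -[RHS](linear0 (cls (pred_of_vspace (lineality R pi)))).
  apply/proj_eq; exists (fun i => (i == j)%:R) => s.
  by rewrite !ffunE in_block subr0.
rewrite linear0 (eq_bigr _ (fun s _ => m1 s)) exchange_big /= (bigD1 j) //=.
rewrite [X in _ + X]big1 ?addr0 => [|i ij]; last first.
  rewrite big1 // => s; rewrite in_block => /eqP ps.
  by case: eqP => [ts|]; rewrite ?mulr0 //; rewrite -ps -ts pt eqxx in ij.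
rewrite (bigD1 (t j)) /=; last by rewrite in_block pt.
rewrite eqxx mulr1 eE big1 ?addr0 => [/esym//|s /andP[_]].
by rewrite eq_sym => /negPf->; rewrite mulr0.
Qed.

Lemma nef_family_basis : is_basis (nef_family R pi).
Proof.
move=> v; have [c vE] := nef_family_spans v; exists c; split=> // c' vE'.
apply/ffunP => k; apply/eqP; rewrite -subr_eq0; apply/eqP.
apply: (nef_family_free (d := fun k => c k - c' k)).
under eq_bigr do rewrite scalerBl.
by rewrite sumrB -vE -vE' subrr.
Qed.

End Basis.

Theorem proposition8p9 (R : realType) (n : nat) (E : finType) (pi : E -> 'I_n)
    (pi_surj : forall i, exists s, pi s = i)
    (block_ge2 : forall i, (2 <= #|block pi i|)%N) :
  [/\
      forall S : {set E}, S != finset.set0 -> colored pi S ->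
      forall T : {set E}, T != finset.set0 -> colored pi T ->
        hmin [set x - ind R S | x in trunc R pi S] (ind R T) =
          fpi R pi S (ray R pi T) - \sum_(s in S) ell R pi s (ray R pi T),
      [/\ forall (i : 'I_n) (s : E), pi s = i ->
            represents (hmax [set ind R [set s] - x | x in simplex R (block pi i)])
                       (alpha R pi i),
          forall S : {set E}, colored pi S -> (2 <= #|S|)%N ->
            represents (hmax [set ind R S - x | x in trunc R pi S])
              (\sum_(i in support_idx pi S) alpha R pi i - pl_cls (fpi R pi S)),
          is_basis (nef_family R pi)
        & forall k, nef (nef_family R pi k)]
    &
      forall S : {set E}, S != finset.set0 -> colored pi S ->
        restricts_to (fun u => hmin (full_trunc R pi S) u - hmin (Delta R pi) u)
                     (fpi R pi S)].
Proof.
split=> [S S0 cS T T0 cT||S S0 cS u su].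
- have bT := colored_blockfree block_ge2 cT.
  rewrite (hmin_translate _ (DTr_is_minimum pi_surj _ S0 (fintype.subxx _))).
  rewrite big1 ?add0r => [|i _]; last exact: blockmin_ind.
  rewrite redmin_ind // fpi_ray // dot_ind; congr (_ - _).
  by apply: eq_bigr => s _; rewrite ell_ray // ffunE.
- split=> [i s <-|S cS S1||[i|A]].
  + rewrite (_ : hmax _ = fun u => u s - blockmin pi u (pi s)).
      exact: represents_alpha.
    apply/funext => u.
    by rewrite (hmax_reflect _ (simplex_is_minimum pi_surj _ _)) dot_ind1.
  + have S0 : S != finset.set0 by rewrite -card_gt0; apply: leq_trans S1.
    rewrite (_ : hmax _ = fun u => dot u (ind R S) -
        (\sum_(i in support_idx pi S) blockmin pi u i + redmin pi S u)).
      exact: represents_trunc.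
    apply/funext => u.
    exact: hmax_reflect (DTr_is_minimum pi_surj _ S0 (fintype.subxx _)).
  + exact: nef_family_basis.
  + exact: nef_alpha.
  + have /andP[cA A1] := valP A.
    by apply: nef_trunc => //; rewrite -card_gt0; apply: leq_trans A1.
- rewrite (hmin_is_minimum (DTr_is_minimum pi_surj u S0 (finset.subsetT _))).
  rewrite (hmin_is_minimum (prod_simplex_is_minimum pi_surj _ u)).
  by rewrite addrAC subrr add0r fpi_proj.
Qed.
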